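(* Let $(X,d_X)$ and $(Y,d_Y)$ be metric spaces, $w$ a weight on $X$, and $\varphi$ a non-negative function on $[0,\infty)$. Assume that $M>0$ is a constant such that for all $x,y\in X$ there exists $\gamma\in\Gamma(x,y)$ with $$\int_\gamma w\le M\,\varphi(d_X(x,y)).$$ Then every $f\in \mathrm{B}_w(X,Y)$ belongs to $\Lambda_\varphi(X,Y)$ and $$\|f\|_{\Lambda_\varphi(X,Y)}\le M\,\|f\|_{\mathrm{B}_w(X,Y)}.$$ In particular, if $\varphi$ is continuous at $0$, $\varphi(0)=0$, and $Y$ is a complete metric space, then every $f\in \mathrm{B}_w(X,Y)$ has a continuous extension to the (minimal) completion of the metric space $X$.
   Context: A weight on a metric space is an everywhere positive and continuous real function on it. For $f:X\to Y$ between metric spaces put $D^\ast f(x)=\limsup_{y\to x}\frac{d_Y(f(x),f(y))}{d_X(x,y)}$ for $x\in X$, with $D^\ast f(x)=0$ if $x$ is isolated. $D^\ast(X,Y)$ is the class of $f:X\to Y$ with $D^\ast f(x)<\infty$ for every $x\in X$. For a weight $w$ on $X$, $\mathrm{B}_w(X,Y)$ is the class of $f\in D^\ast(X,Y)$ for which there is a constant $C_f$ with $D^\ast f(z)\le C_f w(z)$ for all $z\in X$; the least such constant is $\|f\|_{\mathrm{B}_w(X,Y)}$. For a non-negative function $\varphi$ on $[0,\infty)$, $\Lambda_\varphi(X,Y)$ is the class of $f:X\to Y$ for which there is a constant $C_f$ with $d_Y(f(x),f(y))\le C_f\varphi(d_X(x,y))$ for all $x,y\in X$; the infimum of all such $C_f$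 is $\|f\|_{\Lambda_\varphi(X,Y)}$. A curve in $X$ is a continuous map $\gamma:[a,b]\to X$; its length is $\ell(\gamma)=\sup\sum_{i=1}^n d_X(\gamma(t_{i-1}),\gamma(t_i))$ over all partitions $a=t_0<\dots<t_n=b$, and it is rectifiable if $\ell(\gamma)<\infty$. $\Gamma(x,y)$ is the family of rectifiable curves in $X$ with endpoints $x$ and $y$. For a continuous function $g$ on $X$ and a rectifiable curve $\gamma$, $\int_\gamma g$ is the number such that for every $\varepsilon>0$ there is $\delta>0$ with $\left|\int_\gamma g-\sum_{i=1}^n g(\gamma(s_i))\,\ell(\gamma|_{[t_{i-1},t_i]})\right|<\varepsilon$ for every partition $t_0,\dots,t_n$ of $[a,b]$ with $\max_i|t_i-t_{i-1}|<\delta$ and all $s_i\in[t_{i-1},t_i]$ (integral with respect to arc length). *)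

(* Defs.v *)
From mathcomp Require Import all_boot all_order all_algebra.
From mathcomp Require Import all_classical all_reals all_analysis.
Import Order.TTheory GRing.Theory Num.Theory.
Import numFieldNormedType.Exports.

Set Implicit Arguments.
Unset Strict Implicit.
Unset Printing Implicit Defensive.

Local Open Scope classical_set_scope.
Local Open Scope ring_scope.

Section curves.
Context {R : realType} {X : metricType R}.
Implicit Types (a b : R) (gamma : R -> X) (s : seq R).

(* A curve on [a, b] is a total function R -> X, only its values on [a, b]
   matter. As with [itv_partition], [s] lists t_1, ..., t_n while t_0 = a. *)
Definition curve_length a b gamma : \bar R :=
  ereal_sup [set (\sum_(0 <= i < size s)
      mdist (gamma (nth b (a :: s) i)) (gamma (nth b (a :: s) i.+1)))%:E
    | s in itv_partition a b].

Definition rectifiable_curve (x y : X) a b gamma :=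
  [/\ a <= b, {within `[a, b], continuous gamma}, gamma a = x, gamma b = y
    & (curve_length a b gamma < +oo)%E].

(* [I] is the integral of [g] along [gamma] with respect to arc length; [fine]
   is harmless since every subcurve of a rectifiable curve is rectifiable. *)
Definition is_curve_integral (g : X -> R) a b gamma (I : R) :=
  forall eps : R, 0 < eps -> exists2 delta : R, 0 < delta &
    forall (s : seq R) (tag : nat -> R),
      let t i := nth b (a :: s) i in
      itv_partition a b s ->
      (forall i, (i < size s)%N -> `|t i.+1 - t i| < delta) ->
      (forall i, (i < size s)%N -> t i <= tag i <= t i.+1) ->
      `|I - \sum_(0 <= i < size s)
              g (gamma (tag i)) * fine (curve_length (t i) (t i.+1) gamma)|
        < eps.

End curves.

Section function_classes.
Context {R : realType} {X Y : metricType R}.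
Implicit Types (f : X -> Y) (w : X -> R) (phi : R -> R).

Definition weight w := continuous w /\ forall x, 0 < w x.

Definition upper_deriv f (x : X) : \bar R :=
  if `[< isolated [set: X] x >] then 0%E
  else limf_esup (fun y => (mdist (f x) (f y) / mdist x y)%:E) x^'.

Definition Dstar : set (X -> Y) :=
  [set f | forall x, (upper_deriv f x < +oo)%E].

(* Constants are required to be nonnegative, here and in [Lambda_bounds]; this
   only matters on spaces with at most one point, where otherwise the
   infimum could be -oo. *)
Definition Bw_bounds w f : set R :=
  [set C | 0 <= C /\ forall z, (upper_deriv f z <= (C * w z)%:E)%E].

Definition Bw w : set (X -> Y) := [set f | Dstar f /\ Bw_bounds w f !=set0].

Definition Bw_norm w f : R := inf (Bw_bounds w f).

Definition Lambda_bounds phi f : set R :=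
  [set C | 0 <= C /\ forall x y, mdist (f x) (f y) <= C * phi (mdist x y)].

Definition Lambda phi : set (X -> Y) := [set f | Lambda_bounds phi f !=set0].

Definition Lambda_norm phi f : R := inf (Lambda_bounds phi f).

End function_classes.

(* The library's [completeType] forces the space to be pointed; this is the
   same axiom for a possibly empty metric space. *)
Definition complete_metric {R : realType} (T : metricType R) :=
  forall F : set_system T, ProperFilter F -> cauchy F -> exists l : T, F --> l.

Definition is_completion {R : realType} {X Z : metricType R} (j : X -> Z) :=
  [/\ complete_metric Z, forall x y, mdist (j x) (j y) = mdist x y
    & dense (range j)].

(* Main.v *)
Require Import Defs.
From mathcomp Require Import all_boot all_order all_algebra.
From mathcomp Require Import all_classical all_reals all_analysis.
From mathcomp Require Import lra.
Import Order.TTheory GRing.Theory Num.Theory.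
Import numFieldNormedType.Exports.

Local Open Scope classical_set_scope.
Local Open Scope ring_scope.

(** Let C be a constant with D^* f <= C w, and let gamma be a curve from x to y.
The inequality d(f x, f y) <= C I, with I the integral of w along gamma, is a
mean value inequality. Fix e > 0. Since w > 0, at every parameter t one has
D^* f(gamma t) < (C + e) w(gamma t), so that, for z close to gamma t,
d(f(gamma t), f z) <= (C + e) w(gamma t) d(gamma t, z). How close z must be
depends on t, without any uniformity, and compactness of [a, b] enters through
Cousin's lemma ([exists_gauge_partition]): there is a partition such that each of its steps
is controlled by the gauge at one of the two endpoints of that step. Taking
this endpoint as the tag and bounding chords by arc lengths, the triangle
inequality gives
  d(f x, f y) <= (C + e) * (Riemann sum of w for this tagged partition).
The gauge can also be kept below the mesh that the definition of the integral
asks for, hence d(f x, f y) <= (C + e) (I + e), and e tends to 0; this is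
[mdist_le_curve_integral].

With I <= M phi(d(x, y)) it follows that M C is an admissible constant for f in
the class of phi whenever C is admissible for f in the class of w; passing to
the infimum over C compares the norms. If moreover phi tends to 0 = phi 0 at
0, the same bound makes f uniformly continuous, and a uniformly continuous map
into a complete space extends to the completion
([uniformly_continuous_extension]). *)

(** * Partitions fine with respect to a gauge *)

(** A partition is concatenated more easily as a list than through indices:
[pairmap] commutes with concatenation. *)
Lemma partition_sumE (T : zmodType) (V : Type) (h : V -> V -> T) x0 a (s : seq V) :
  \sum_(0 <= i < size s) h (nth x0 (a :: s) i) (nth x0 (a :: s) i.+1) =
  \sum_(z <- pairmap h a s) z.
Proof.
rewrite [RHS](big_nth 0) size_pairmap.
by apply: eq_big_nat => i /andP[_ si]; rewrite (nth_pairmap x0).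
Qed.

Lemma mdist_le_partition_sum {R : realType} {T : Type} {Y : metricType R}
    (F : T -> Y) x0 a (s : seq T) :
  mdist (F a) (F (last a s)) <= \sum_(0 <= i < size s)
    mdist (F (nth x0 (a :: s) i)) (F (nth x0 (a :: s) i.+1)).
Proof.
rewrite (partition_sumE _ _ (fun u v => mdist (F u) (F v))).
elim: s a => [|u s ih] a /=; first by rewrite big_nil mdistxx.
by rewrite big_cons (le_trans (metric_triangle _ (F u) _))// lerD2l.
Qed.

(** Cousin's lemma, with tags at endpoints. A partition whose tags are interior
to the steps can always be cut at its tags, so nothing is lost, and only one
chord per step has to be estimated. The proof considers the supremum c of the
points t for which [a, t] has such a partition: a point just below c is joined
to c by a step controlled by r c, and if c < b another step controlled by r c
goes beyond c. *)
Lemma exists_gauge_partition {R : realType} (a b : R) (r : R -> R) :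
  a <= b -> (forall t, a <= t <= b -> 0 < r t) ->
  exists2 s, itv_partition a b s &
    path (fun u v => v - u < Num.max (r u) (r v)) a s.
Proof.
move=> ab r0; set e := fun u v : R => v - u < Num.max (r u) (r v).
pose S := [set t | a <= t <= b /\ exists2 s, itv_partition a t s & path e a s].
have step t u : S t -> t < u <= b -> e t u -> S u.
  move=> [/andP[at_ tb] [s [sp /eqP sl] se]] /andP[tu ub] etu.
  split; first by rewrite ub (le_trans at_ (ltW tu)).
  exists (rcons s u); last by rewrite rcons_path se sl.
  by split; rewrite ?last_rcons// rcons_path sp sl.
have Sa : S a by split; [rewrite lexx|exists [::]].
have supS : has_sup S by split; [exists a|exists b => t [/andP[]]].
have Sle : ubound S (sup S) by exact: sup_upper_bound.
set c := sup S in Sle *.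
have ac : a <= c by exact: Sle.
have cb : c <= b by apply: ge_sup => [|t [/andP[]]//]; exists a.
have rc : 0 < r c by rewrite r0// ac.
have Sc : S c.
  have [t St ct] := sup_adherent rc supS.
  have := Sle _ St; rewrite le_eqVlt => /predU1P[<-//|tc].
  apply: step St _ _; first by rewrite tc.
  by rewrite /e lt_max; apply/orP; right; move: ct; rewrite -/c; lra.
move: cb; rewrite le_eqVlt => /predU1P[<-|cb]; first by case: Sc.
have cu : c < Num.min b (c + r c / 2) by rewrite lt_min cb/=; lra.
have : S (Num.min b (c + r c / 2)).
  apply: step Sc _ _; first by rewrite cu ge_min lexx.
  rewrite /e lt_max; apply/orP; left.
  have : Num.min b (c + r c / 2) <= c + r c / 2 by rewrite ge_min lexx orbT.
  lra.
by move=> /Sle; rewrite leNgt cu.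
Qed.

(** * Length of subcurves *)

(** This makes the lengths of subcurves of a rectifiable curve finite, so that
[fine] does not send them to 0 in Riemann sums. *)
Lemma curve_length_sub {R : realType} {X : metricType R} (gamma : R -> X)
    (a b u v : R) : a <= u -> u <= v -> v <= b ->
  (curve_length u v gamma <= curve_length a b gamma)%E.
Proof.
move=> au uv vb; apply: ge_ereal_sup => _ [s suv <-].
have [s1 s1P] : exists s1, itv_partition a u s1.
  move: au; rewrite le_eqVlt => /predU1P[->|au]; first by exists [::].
  by exists [:: u]; exact: itv_partition1.
have [s2 s2P] : exists s2, itv_partition v b s2.
  move: vb; rewrite le_eqVlt => /predU1P[->|vb]; first by exists [::].
  by exists [:: b]; exact: itv_partition1.
have s12 := itv_partition_cat s1P (itv_partition_cat suv s2P).
apply: le_ereal_sup_tmp; eexists; first by exists (s1 ++ s ++ s2).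
rewrite lee_fin.
rewrite !(partition_sumE _ _ (fun x y => mdist (gamma x) (gamma y))).
have pos x t : 0 <= \sum_(z <- pairmap
    (fun x y => mdist (gamma x) (gamma y)) x t) z.
  elim: t x => [|y t ih] x /=; first by rewrite big_nil.
  by rewrite big_cons addr_ge0// mdist_ge0.
have [_ /eqP ls1] := s1P.
by rewrite pairmap_cat ls1 pairmap_cat !big_cat/= ler_wpDl// ler_wpDr.
Qed.

Lemma mdist_le_curve_length {R : realType} {X : metricType R} (gamma : R -> X)
    (a b u v : R) : a <= u -> u <= v -> v <= b ->
  (curve_length a b gamma < +oo)%E ->
  mdist (gamma u) (gamma v) <= fine (curve_length u v gamma).
Proof.
move=> au uv vb fin.
have [->|u_neq_v] := eqVneq u v.
  rewrite mdistxx fine_ge0//.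
  apply: ereal_sup_ubound; exists [::]; rewrite ?big_nil//.
have {u_neq_v}uv : u < v by rewrite lt_neqAle u_neq_v.
rewrite -lee_fin.
have le_len : ((mdist (gamma u) (gamma v))%:E <= curve_length u v gamma)%E.
  apply: ereal_sup_ubound; exists [:: v]; first exact: itv_partition1.
  by rewrite big_nat1.
rewrite fineK// fin_numElt (lt_le_trans _ le_len) ?ltNyr//=.
by rewrite (le_lt_trans _ fin)// curve_length_sub// ltW.
Qed.

(** * Integrating the upper derivative *)

(** Both cases of the upper derivative yield this: near an isolated point there
is no other point, and at y = z the inequality reads 0 <= 0, which also fills
the hole of the punctured neighborhoods. *)
Lemma upper_deriv_lt_locally {R : realType} {X Y : metricType R} (f : X -> Y)
    z (K : R) : (upper_deriv f z < K%:E)%E ->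
  \forall y \near z, mdist (f z) (f y) <= K * mdist z y.
Proof.
rewrite /upper_deriv; case: asboolP => [[_ [V Vz VE]] _|_].
  apply: filterS Vz => y Vy.
  have -> : y = z by have : (V `&` setT) y by []; rewrite VE.
  by rewrite !mdistxx mulr0.
rewrite limf_esupE => /ereal_inf_lt[_ [V Vz <-]] VK.
have : \forall y \near z, y != z -> V y by exact: Vz.
apply: filterS => y Vy.
have [->|yz] := eqVneq y z; first by rewrite !mdistxx mulr0.
rewrite -ler_pdivrMr ?mdist_gt0 1?eq_sym// -lee_fin (le_trans _ (ltW VK))//.
by apply: ereal_sup_ubound; exists y => //; exact: Vy.
Qed.

(** The mean value inequality along a curve. The error e is added to C rather
than to C * w, which is possible because w is positive: the total error is then
e times the Riemann sum itself, which the convergence of Riemann sums already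
bounds. *)
Lemma mdist_le_curve_integral {R : realType} {X Y : metricType R}
    (w : X -> R) (f : X -> Y) (C : R) (x y : X) (a b : R) (gamma : R -> X)
    (I : R) :
  (forall z, 0 < w z) -> 0 <= C ->
  (forall z, (upper_deriv f z <= (C * w z)%:E)%E) ->
  rectifiable_curve x y a b gamma -> is_curve_integral w a b gamma I ->
  mdist (f x) (f y) <= C * I.
Proof.
move=> w0 C0 fC [ab cgamma gx gy fin] int.
suff key e : 0 < e -> 0 <= I + e /\ mdist (f x) (f y) <= (C + e) * (I + e).
  have I0 : 0 <= I by apply/ler_addgt0Pr => e /key[].
  have D0 : 0 < C + I + 1 by lra.
  apply/ler_addgt0Pr => e e0.
  (* For d <= 1, (C + d)(I + d) - C I <= d (C + I + 1), whence this choice. *)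
  pose d := Num.min 1 (e / (C + I + 1)).
  have d0 : 0 < d by rewrite lt_min ltr01 divr_gt0.
  have [_ /le_trans] := key _ d0; apply.
  have d1 : d <= 1 by rewrite ge_min lexx.
  have : d * (C + I + 1) <= e.
    by rewrite -ler_pdivlMr// ge_min lexx orbT.
  have : d * d <= d by rewrite ler_piMr// ltW.
  nra.
move=> e0.
have [delta delta0 intP] := int _ e0.
have local t : exists r : R, 0 < r /\ (a <= t <= b ->
    forall u, a <= u <= b -> `|t - u| < r ->
    mdist (f (gamma t)) (f (gamma u)) <=
      (C + e) * w (gamma t) * mdist (gamma t) (gamma u)).
  have [tab|] := boolP (a <= t <= b); last by exists 1.
  have : (upper_deriv f (gamma t) < ((C + e) * w (gamma t))%:E)%E.
    by rewrite (le_lt_trans (fC _))// lte_fin ltr_pM2r// ltrDl.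
  move=> /upper_deriv_lt_locally lip.
  have tI : `[a, b]%classic t by rewrite /= in_itv.
  have /subspace_continuousP/(_ t tI)/(_ _ lip) := cgamma.
  rewrite /= nbhs_simpl /within /= => /nbhs_ballP[r r0 rP].
  exists r; split => // _ u uab tu; apply: rP => //=.
have [r rP] := choice local.
pose g t := Num.min delta (r t).
have [|s sab sg] := exists_gauge_partition a b g ab.
  by move=> t _; rewrite lt_min delta0; case: (rP t).
pose t i := nth b (a :: s) i.
have stepP i : (i < size s)%N -> [/\ a <= t i, t i < t i.+1, t i.+1 <= b &
    t i.+1 - t i < Num.max (g (t i)) (g (t i.+1))].
  move=> si; split.
  - by apply: itv_partition_nth_ge => //; exact: ltnW.
  - by case: sab => /(pathP b)/(_ i si).
  - exact: itv_partition_nth_le.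
  - by move: sg => /(pathP b)/(_ i si).
pose tag i := if t i.+1 - t i < g (t i) then t i else t i.+1.
have bnd : mdist (f x) (f y) <= (C + e) * \sum_(0 <= i < size s)
    w (gamma (tag i)) * fine (curve_length (t i) (t i.+1) gamma).
  have [_ /eqP sl] := sab.
  have := mdist_le_partition_sum (f \o gamma) b a s.
  rewrite /= sl gx gy => /le_trans; apply.
  rewrite big_distrr/=; apply: ler_sum_nat => i /andP[_ si].
  have [ai ii ib gi] := stepP i si.
  have len := mdist_le_curve_length gamma a b _ _ ai (ltW ii) ib fin.
  have Ce0 : 0 <= C + e by lra.
  suff : mdist (f (gamma (t i))) (f (gamma (t i.+1))) <=
      (C + e) * w (gamma (tag i)) * mdist (gamma (t i)) (gamma (t i.+1)).
    move=> /le_trans; apply; rewrite -mulrA; apply: ler_wpM2l => //.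
    by apply: ler_wpM2l len; exact: ltW.
  rewrite /tag; case: ifPn => [gi'|/negbTE gi'].
    case: (rP (t i)) => _; apply.
    - by rewrite ai/=; lra.
    - by rewrite ib andbT; lra.
    - rewrite distrC ger0_norm; last lra.
      by rewrite (lt_le_trans gi')// ge_min lexx orbT.
  rewrite metric_sym [in leRHS]metric_sym.
  case: (rP (t i.+1)) => _; apply.
  - by rewrite ib andbT; lra.
  - by rewrite ai/=; lra.
  - rewrite ger0_norm; last lra.
    move: gi; rewrite lt_max gi'/= => /lt_le_trans; apply.
    by rewrite ge_min lexx orbT.
set S := \sum_(0 <= i < size s) _ in bnd.
have S0 : 0 <= S.
  rewrite /S big_nat; apply: sumr_ge0 => i /andP[_ si].
  have [ai ii ib _] := stepP i si.
  rewrite mulr_ge0 ?(ltW (w0 _))//.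
  apply: le_trans (mdist_le_curve_length gamma a b _ _ ai (ltW ii) ib fin).
  exact: mdist_ge0.
have : `|I - S| < e.
  apply: intP => // i si; have [_ ii _ gi] := stepP i si.
    rewrite ger0_norm; last by rewrite subr_ge0 ltW.
    by rewrite (lt_le_trans gi)// ge_max !ge_min !lexx.
  by rewrite /tag; case: ifP => _; rewrite lexx (ltW ii).
rewrite ltr_distlC => /andP[IS SI].
split; first lra.
by rewrite (le_trans bnd)// ler_wpM2l//; lra.
Qed.

(** * Extension to a completion *)

(** The value at z is the limit of f along the filter generated by the images
of the sets of points of X lying close to z. These sets are nonempty because
the range of j is dense, and the filter is Cauchy because f is uniformly
continuous and j is isometric. *)
Lemma uniformly_continuous_extension {R : realType} {X Y Z : metricType R}
    (f : X -> Y) (j : X -> Z) :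
  complete_metric Y ->
  (forall x y, mdist (j x) (j y) = mdist x y) -> dense (range j) ->
  (forall e : R, 0 < e -> exists2 d : R, 0 < d &
     forall x y, mdist x y < d -> mdist (f x) (f y) < e) ->
  exists2 g : Z -> Y, continuous g & forall x : X, g (j x) = f x.
Proof.
move=> cY jiso jd fuc.
have approx z (d : R) : 0 < d -> exists x, mdist z (j x) < d.
  move=> d0; have [||u [/interior_subset zu [x _ xu]]] := jd (ball z d)°.
  - by exists z; exact: nbhsx_ballx.
  - exact: open_interior.
  - by move: zu; rewrite -xu ballEmdist; exists x.
have lim z : exists l : Y, forall e : R, 0 < e -> exists2 d : R, 0 < d &
    forall x, mdist z (j x) < d -> mdist l (f x) < e.
  pose F : set_system Y := filter_from [set d : R | 0 < d]
    (fun d => f @` [set x | mdist z (j x) < d]).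
  have PF : ProperFilter F.
    apply: filter_from_proper; last first.
      by move=> d /(approx z)[x zx]; exists (f x), x.
    apply: filter_from_filter; first by exists 1 => /=.
    move=> d1 d2 /= d10 d20; exists (Num.min d1 d2) => /=.
      by rewrite lt_min d10.
    by move=> u [x /=]; rewrite lt_min => /andP[xd1 xd2] xu; split; exists x.
  have /cY[l Fl] : cauchy F.
    apply/cauchyP => e /fuc[d d0 dP].
    have [|x zx] := approx z (d / 2); first by rewrite divr_gt0.
    exists (f x), (d / 2); first by rewrite /= divr_gt0.
    move=> _ [u /= zu <-]; rewrite ballEmdist; apply: dP.
    rewrite -jiso (le_lt_trans (metric_triangle _ z _))// metric_sym; lra.
  exists l => e e0.
  have [d d0 dP] : F (ball l e) by apply: Fl; exact: nbhsx_ballx.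
  exists d => // x zx; have : ball l e (f x) by apply: dP; exists x.
  by rewrite ballEmdist.
have [g gP] := choice lim.
exists g.
  move=> z; apply/metricType_numDomainType.cvgrPdist_lt => e e0.
  have [|d d0 dP] := fuc (e / 3); first by rewrite divr_gt0.
  apply/nbhs_ballP; exists (d / 3); first by rewrite /= divr_gt0.
  rewrite ballEmdist => u /= zu.
  have e3 : 0 < e / 3 by rewrite divr_gt0.
  have near v : exists2 x, mdist v (j x) < d / 3 & mdist (g v) (f x) < e / 3.
    have [d' d'0 d'P] := gP v _ e3.
    have [|x] := approx v (Num.min (d / 3) d').
      by rewrite lt_min d'0 divr_gt0.
    by rewrite lt_min => /andP[? /d'P]; exists x.
  have [x zx gx] := near z; have [y uy gy] := near u.
  have xy : mdist x y < d.
    rewrite -jiso; have := metric_triangle (j x) z (j y).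
    have := metric_triangle z u (j y); rewrite (metric_sym (j x) z); lra.
  have := metric_triangle (g z) (f x) (g u).
  have := metric_triangle (f x) (f y) (g u).
  have := dP _ _ xy; rewrite (metric_sym (f y) (g u)); lra.
move=> x; apply: mdist_positivity; apply/eqP.
rewrite eq_le mdist_ge0 andbT; apply/ler_addgt0Pr => e e0; rewrite add0r ltW//.
by have [d d0] := gP (j x) _ e0; apply; rewrite mdistxx.
Qed.

Theorem theorem3p1 (R : realType) (X Y : metricType R)
    (w : X -> R) (phi : R -> R) (M : R)
    (hw : weight w)
    (hphi : forall t : R, 0 <= t -> 0 <= phi t)
    (hM : 0 < M)
    (hcurve : forall x y : X, exists (a b : R) (gamma : R -> X) (I : R),
        [/\ rectifiable_curve x y a b gamma,
            is_curve_integral w a b gamma I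
          & I <= M * phi (mdist x y)]) :
  (forall f : X -> Y, Bw w f ->
      Lambda phi f /\ Lambda_norm phi f <= M * Bw_norm w f)
  /\
  (phi t @[t --> within [set t : R | 0 <= t] (nbhs (0 : R))] --> phi 0 ->
   phi 0 = 0 ->
   complete_metric Y ->
   forall f : X -> Y, Bw w f ->
   forall (Z : metricType R) (j : X -> Z), is_completion j ->
   exists2 g : Z -> Y, continuous g & forall x : X, g (j x) = f x).
Proof.
have bound (f : X -> Y) C : Bw_bounds w f C -> Lambda_bounds phi f (M * C).
  move=> [C0 fC]; split; first by rewrite mulr_ge0// ltW.
  move=> x y; have [a [b [gamma [I [rect int IM]]]]] := hcurve x y.
  case: hw => _ w0.
  apply: le_trans (mdist_le_curve_integral _ _ _ _ _ _ _ _ _ w0 C0 fC rect int) _.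
  by rewrite (mulrC M) -mulrA ler_wpM2l.
split=> [f [_ [C fC]]|phic phi0 cY f [_ [C fC]] Z j [_ jiso jd]].
  split; first by exists (M * C); exact: bound.
  rewrite -ler_pdivrMl//; apply: lb_le_inf; first by exists C.
  move=> D /bound fD; rewrite ler_pdivrMl//.
  by apply: ge_inf fD; exists 0 => ? [].
apply: uniformly_continuous_extension cY jiso jd _ => e e0.
have [K0 fK] := bound f C fC; set K := M * C in K0 fK.
(* K may vanish, hence the division by K + 1 below. *)
have K1 : 0 < K + 1 by lra.
have := phic; rewrite phi0 => /cvgrPdist_lt/(_ (e / (K + 1))).
rewrite divr_gt0// => /(_ isT).
rewrite near_withinE => /nbhs_ballP[d d0 dP]; exists d => // x y xy.
have := dP (mdist x y); rewrite /ball/= !sub0r !normrN ger0_norm ?mdist_ge0//.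
move=> /(_ xy isT); rewrite ltr_pdivlMr// => lt_e.
rewrite (le_lt_trans (fK _ _))// (le_lt_trans _ lt_e)//.
have := hphi _ (mdist_ge0 x y) => p0.
rewrite ger0_norm//; nra.
Qed.
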